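(* Let $\mathcal{F}=\{f_{n}\}_{n\in\mathbb{N}}$ and $\mathcal{G}=\{g_{n}\}_{n\in\mathbb{N}}$ be time varying maps on metric spaces $(X,d_{1})$ and $(Y,d_{2})$, respectively, such that $\mathcal{F}$ is uniformly conjugate to $\mathcal{G}$. Then the following statements hold: (a) If $\mathcal{F}$ has the h-shadowing property, then so does $\mathcal{G}$. (b) If $\mathcal{F}$ has the limit shadowing property, then so does $\mathcal{G}$. (c) If $\mathcal{F}$ has the s-limit shadowing property, then so does $\mathcal{G}$.
   Context: $\mathbb{N}=\{1,2,3,\dots\}$. A time varying map on a metric space $(X,d)$ is a sequence $\mathcal{F}=\{f_n\}_{n\in\mathbb{N}}$ of continuous maps $f_n:X\to X$. Put $\mathcal{F}_n:=f_n\circ f_{n-1}\circ\cdots\circ f_1$ for $n\ge 1$ and $\mathcal{F}_0:=\mathrm{Id}_X$. Uniform conjugacy: $\mathcal{F}$ on $X$ and $\mathcal{G}$ on $Y$ are uniformly conjugate if there is a homeomorphism $h:X\to Y$ with $h$ and $h^{-1}$ uniformly continuous such that $h\circ f_n=g_n\circ h$ for all $n\in\mathbb{N}$. For $\delta>0$, a sequence $\{x_n\}_{n\ge 0}$ in $X$ is a $\delta$-pseudo orbit of $\mathcal{F}$ if $d(f_{n+1}(x_n),x_{n+1})<\delta$ for all $n\ge 0$; a finite sequence $\{x_0,\dots,x_m\}$ is a finite $\delta$-pseudo orbit if $d(f_{n+1}(x_n),x_{n+1})<\delta$ for all $0\le n<m$. A sequence $\{x_n\}_{n\ge0}$ is a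 limit pseudo orbit if $d(f_{n+1}(x_n),x_{n+1})\to 0$ as $n\to+\infty$. h-shadowing property: for every $\varepsilon>0$ there is $\delta>0$ such that for every finite $\delta$-pseudo orbit $\{x_0,\dots,x_m\}$ in $X$ there is $x\in X$ with $d(\mathcal{F}_n(x),x_n)<\varepsilon$ for every $0\le n<m$ and $\mathcal{F}_m(x)=x_m$. Limit shadowing property: for every limit pseudo orbit $\{x_n\}_{n\ge0}$ in $X$ there is $x\in X$ with $d(\mathcal{F}_n(x),x_n)\to 0$ as $n\to+\infty$. s-limit shadowing property: for every $\varepsilon>0$ there is $\delta>0$ such that (1) for every $\delta$-pseudo orbit $\{x_n\}_{n\ge0}$ in $X$ there exists $x\in X$ with $d(\mathcal{F}_n(x),x_n)<\varepsilon$ for all $n\ge 0$, and (2) if in addition $\{x_n\}_{n\ge0}$ is a limit pseudo orbit, then (this $x$ can be taken so that) $d(\mathcal{F}_n(x),x_n)\to0$ as $n\to+\infty$. *)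

(* Defs.v *)
From mathcomp Require Import all_boot all_order all_algebra.
From mathcomp Require Import all_classical all_reals topology normedtype.

Set Implicit Arguments.
Unset Strict Implicit.
Unset Printing Implicit Defensive.

Import Order.TTheory GRing.Theory Num.Theory.
Import numFieldNormedType.Exports.

Local Open Scope classical_set_scope.
Local Open Scope ring_scope.

(* A sequence {f_n}, n >= 1, is encoded as f : nat -> X -> X; the value f 0 is
   never used, and no hypothesis is made on it. *)
Definition time_varying_map (R : realType) (X : metricType R)
    (f : nat -> X -> X) : Prop :=
  forall n : nat, (0 < n)%N -> continuous (f n).

(* f_n \o ... \o f_1 *)
Fixpoint tv_comp (X : Type) (f : nat -> X -> X) (n : nat) : X -> X :=
  if n is n'.+1 then f n'.+1 \o tv_comp f n' else id.

Definition homeomorphism_with_inverse (X Y : topologicalType)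
    (h : X -> Y) (k : Y -> X) : Prop :=
  [/\ cancel h k, cancel k h, continuous h & continuous k].

Definition uniformly_conjugate (R : realType) (X Y : metricType R)
    (f : nat -> X -> X) (g : nat -> Y -> Y) : Prop :=
  exists (h : X -> Y) (k : Y -> X),
    [/\ homeomorphism_with_inverse h k,
        unif_continuous h,
        unif_continuous k &
        forall n : nat, (0 < n)%N -> h \o f n =1 g n \o h].

Section Shadowing.
Variables (R : realType) (X : metricType R).
Implicit Types (f : nat -> X -> X) (x : nat -> X).

Definition pseudo_orbit f (delta : R) x : Prop :=
  forall n : nat, mdist (f n.+1 (x n)) (x n.+1) < delta.

(* The finite sequence is x 0, ..., x m; later values of x are irrelevant. *)
Definition finite_pseudo_orbit f (delta : R) (m : nat) x : Prop :=
  forall n : nat, (n < m)%N -> mdist (f n.+1 (x n)) (x n.+1) < delta.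

Definition limit_pseudo_orbit f x : Prop :=
  mdist (f n.+1 (x n)) (x n.+1) @[n --> \oo] --> (0 : R).

Definition h_shadowing f : Prop :=
  forall eps : R, 0 < eps -> exists2 delta : R, 0 < delta &
    forall (m : nat) x, finite_pseudo_orbit f delta m x ->
      exists z : X,
        (forall n : nat, (n < m)%N -> mdist (tv_comp f n z) (x n) < eps) /\
        tv_comp f m z = x m.

Definition limit_shadowing f : Prop :=
  forall x, limit_pseudo_orbit f x ->
    exists z : X, mdist (tv_comp f n z) (x n) @[n --> \oo] --> (0 : R).

(* In the second clause the same point both eps-shadows and limit-shadows. *)
Definition s_limit_shadowing f : Prop :=
  forall eps : R, 0 < eps -> exists2 delta : R, 0 < delta &
    (forall x, pseudo_orbit f delta x ->
       exists z : X, forall n : nat, mdist (tv_comp f n z) (x n) < eps) /\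
    (forall x, pseudo_orbit f delta x -> limit_pseudo_orbit f x ->
       exists z : X,
         (forall n : nat, mdist (tv_comp f n z) (x n) < eps) /\
         mdist (tv_comp f n z) (x n) @[n --> \oo] --> (0 : R)).

End Shadowing.

(* Main.v *)
Require Import Defs.
From mathcomp Require Import all_boot all_order all_algebra.
From mathcomp Require Import all_classical all_reals topology normedtype.

(** Pull a pseudo orbit of [g] back along [h^-1], shadow it for [f], and push
    the shadowing point forward along [h]; uniform continuity of [h^-1] controls
    the first step and that of [h] the last one. *)

Import Order.TTheory GRing.Theory Num.Theory.
Import numFieldNormedType.Exports.

Local Open Scope classical_set_scope.
Local Open Scope ring_scope.

Lemma unif_continuous_mdist {R : realType} {X Y : metricType R} {h : X -> Y} :
  unif_continuous h -> forall e : R, 0 < e -> exists2 d : R, 0 < d &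
    forall a b : X, mdist a b < d -> mdist (h a) (h b) < e.
Proof.
move=> /unif_continuousP hh e e0; have [d d0 hd] := hh e e0.
by exists d => // a b ab; have := hd (a, b); rewrite !ballEmdist /=; apply.
Qed.

(** Neither [u] nor [v] is assumed to converge, so continuity at a point would not suffice: one
    modulus of [h] has to serve all pairs [(u t, v t)] at once. *)
Lemma unif_continuous_mdist_cvg0 {R : realType} {X Y : metricType R}
    {h : X -> Y} {T : Type} {F : set_system T} {FF : Filter F} (u v : T -> X) :
  unif_continuous h -> mdist (u t) (v t) @[t --> F] --> (0 : R) ->
  mdist (h (u t)) (h (v t)) @[t --> F] --> (0 : R).
Proof.
move=> /unif_continuous_mdist hh /cvgr0Pnorm_lt uv.
apply/cvgr0Pnorm_lt => e e0; have [d d0 hd] := hh e e0.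
have := uv d d0; apply: filterS => t.
by rewrite !ger0_norm ?mdist_ge0//; exact: hd.
Qed.

Lemma tv_comp_semiconj {X Y : Type} {f : nat -> X -> X} {g : nat -> Y -> Y}
    {h : X -> Y} (hfg : forall n, (0 < n)%N -> h \o f n =1 g n \o h) n z :
  h (tv_comp f n z) = tv_comp g n (h z).
Proof. by elim: n => //= n IHn; rewrite -IHn; exact: hfg. Qed.

Section Conjugacy.
Context {R : realType} {X Y : metricType R}.
Context {f : nat -> X -> X} {g : nat -> Y -> Y} {h : X -> Y} {k : Y -> X}.
Hypotheses (hK : cancel h k) (kK : cancel k h).
Hypotheses (huc : unif_continuous h) (kuc : unif_continuous k).
Hypothesis hfg : forall n : nat, (0 < n)%N -> h \o f n =1 g n \o h.

(** Because of this, the one-step errors of [k \o y] under [f] are distances between [k]-images of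
    the points whose distances are the one-step errors of [y] under [g]. *)
Lemma conj_inv n y : k (g n.+1 y) = f n.+1 (k y).
Proof. by rewrite -{1}(kK y) -[g _ _](hfg n.+1 isT) /= hK. Qed.

Lemma limit_pseudo_orbit_inv y :
  limit_pseudo_orbit g y -> limit_pseudo_orbit f (k \o y).
Proof.
move=> /(unif_continuous_mdist_cvg0 _ _ kuc).
by rewrite /limit_pseudo_orbit; under eq_fun do rewrite conj_inv.
Qed.

Lemma limit_shadow_conj y z :
  mdist (tv_comp f n z) (k (y n)) @[n --> \oo] --> (0 : R) ->
  mdist (tv_comp g n (h z)) (y n) @[n --> \oo] --> (0 : R).
Proof.
move=> /(unif_continuous_mdist_cvg0 _ _ huc).
by under eq_fun do rewrite (tv_comp_semiconj hfg) kK.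
Qed.

Lemma h_shadowing_conj : h_shadowing f -> h_shadowing g.
Proof.
(* Constants are chosen backwards: [e'] from [e] by the modulus of [h], [d'] from [e'] by shadowing
   for [f], [d] from [d'] by the modulus of [k]. *)
move=> fS e e0; have [e' e'0 he'] := unif_continuous_mdist huc e e0.
have [d' d'0 hd'] := fS e' e'0.
have [d d0 hd] := unif_continuous_mdist kuc d' d'0.
exists d => // m y yP.
have [|z [zy zm]] := hd' m (k \o y).
  by move=> n nm; rewrite /= -conj_inv; exact/hd/yP.
(* The exact hit at time [m] survives because [h] sends the endpoint [k (y m)] back to [y m]; only
   the earlier times need the modulus of [h]. *)
exists (h z); split; last by rewrite -(tv_comp_semiconj hfg) zm /= kK.
by move=> n /zy /he'; rewrite (tv_comp_semiconj hfg) /= kK.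
Qed.

Lemma limit_shadowing_conj : limit_shadowing f -> limit_shadowing g.
Proof.
move=> fS y /limit_pseudo_orbit_inv /fS [z zy].
by exists (h z); exact: limit_shadow_conj.
Qed.

Lemma s_limit_shadowing_conj : s_limit_shadowing f -> s_limit_shadowing g.
Proof.
move=> fS e e0; have [e' e'0 he'] := unif_continuous_mdist huc e e0.
have [d' d'0 [hd' hd'lim]] := fS e' e'0.
have [d d0 hd] := unif_continuous_mdist kuc d' d'0.
have pull y : pseudo_orbit g d y -> pseudo_orbit f d' (k \o y).
  by move=> yP n; rewrite /= -conj_inv; exact/hd/yP.
have push y z : (forall n, mdist (tv_comp f n z) (k (y n)) < e') ->
    forall n, mdist (tv_comp g n (h z)) (y n) < e.
  by move=> zy n; have /he' := zy n; rewrite (tv_comp_semiconj hfg) kK.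
exists d => //; split=> y /pull yP.
  by have [z zy] := hd' _ yP; exists (h z); exact: push.
(* One [z] both [e']-shadows and limit-shadows [k \o y], so its image [h z] inherits both properties
   together. *)
move=> /limit_pseudo_orbit_inv ylim; have [z [zy zlim]] := hd'lim _ yP ylim.
by exists (h z); split; [exact: push | exact: limit_shadow_conj].
Qed.

End Conjugacy.

Theorem theorem3p1 (R : realType) (X Y : metricType R)
    (f : nat -> X -> X) (g : nat -> Y -> Y)
    (hf : time_varying_map f) (hg : time_varying_map g)
    (hfg : uniformly_conjugate f g) :
  [/\ (h_shadowing f -> h_shadowing g),
      (limit_shadowing f -> limit_shadowing g) &
      (s_limit_shadowing f -> s_limit_shadowing g)].
Proof.
have [h [k [[hK kK _ _] huc kuc hfgn]]] := hfg.
split.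
- exact: (h_shadowing_conj hK kK huc kuc hfgn).
- exact: (limit_shadowing_conj hK kK huc kuc hfgn).
- exact: (s_limit_shadowing_conj hK kK huc kuc hfgn).
Qed.
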